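(* Let $G_{\mathbb R}=\mathrm{SL}_n(\mathbb R)$, $\mathfrak g_{\mathbb R}=\mathfrak{sl}_n(\mathbb R)$, $G=\mathrm{SL}_n(\mathbb C)$, $\mathfrak g=\mathfrak{sl}_n(\mathbb C)$. Then for every hyperbolic semisimple element $x\in\mathfrak g_{\mathbb R}$ we have $$\lim_{\nu\to0^+}G_{\mathbb R}\cdot(\nu x)=(G\cdot\mathfrak u(x))\cap\mathfrak g_{\mathbb R}=\overline{\mathcal O_{\mathrm{Rich}}(x)}\cap\mathfrak g_{\mathbb R}.$$
   Context: Here $n\ge 2$ and the dot denotes the adjoint action. A semisimple $x\in\mathfrak g_{\mathbb R}$ is hyperbolic if $\mathrm{ad}(x)$ is diagonalizable with real eigenvalues. For such $x$ and $\mu\in\mathbb R$ let $\mathfrak g_\mu=\{z\in\mathfrak g\mid[x,z]=\mu z\}$ and $\mathfrak u(x)=\bigoplus_{\mu>0}\mathfrak g_\mu$. For $x\in\mathfrak g_{\mathbb R}$, $$\lim_{\nu\to 0^+}G_{\mathbb R}\cdot(\nu x):=\bigcap_{\epsilon>0}\overline{\bigcup_{\nu\in(0,\epsilon)}G_{\mathbb R}\cdot(\nu x)},$$ with closures in the Euclidean topology of $\mathfrak g_{\mathbb R}$. $\mathcal O_{\mathrm{Rich}}(x)$ is the Richardson orbit of $x$: the unique dense $G$-orbit in $G\cdot\mathfrak u$, where $\mathfrak u$ is the nilradical of any parabolic subalgebra of $\mathfrak g$ having the centralizer $\mathfrak g^x$ as a Levi factor (for instance $\mathfrak u=\mathfrak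 u(x)$); $\overline{\mathcal O_{\mathrm{Rich}}(x)}$ is its Zariski closure in $\mathfrak g$. *)

(* Defs.v *)
From HB Require Import structures.
From mathcomp Require Import all_boot all_order all_algebra.
From mathcomp Require Import all_classical all_reals all_analysis.
From mathcomp Require Import complex.
From mathcomp Require mpoly.

Set Implicit Arguments.
Unset Strict Implicit.
Unset Printing Implicit Defensive.

Import Order.TTheory GRing.Theory Num.Theory.
Import numFieldNormedType.Exports.

Local Open Scope classical_set_scope.
Local Open Scope ring_scope.
Local Open Scope complex_scope.

Definition sl (F : fieldType) (n : nat) : {vspace 'M[F]_n} :=
  lker (linfun (@mxtrace F n : 'M[F]_n -> F^o)).

Lemma mem_sl (F : fieldType) (n : nat) (z : 'M[F]_n) :
  (z \in sl F n) = (\tr z == 0).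
Proof. by rewrite memv_ker lfunE. Qed.

Definition SL (F : fieldType) (n : nat) : set 'M[F]_n :=
  [set g | \det g = 1].

Definition Ad (F : fieldType) (n : nat) (g z : 'M[F]_n) : 'M[F]_n :=
  g *m z *m invmx g.

Definition ad (F : fieldType) (n : nat) (x z : 'M[F]_n) : 'M[F]_n :=
  x *m z - z *m x.

Definition saturation (F : fieldType) (n : nat) (A : set 'M[F]_n) :
  set 'M[F]_n := [set y | exists2 g, SL g & exists2 z, A z & y = Ad g z].

Definition orbit (F : fieldType) (n : nat) (z : 'M[F]_n) : set 'M[F]_n :=
  saturation [set z].

Definition cmx (R : realType) (n : nat) (x : 'M[R]_n) : 'M[R[i]]_n :=
  map_mx (@real_complex R) x.

(* Semisimplicity of an element of sl_n: its adjoint endomorphism of sl_n is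
   diagonalizable (used over the complex numbers only). *)
Definition ad_diagonalizable (F : fieldType) (n : nat) (x : 'M[F]_n) : Prop :=
  exists2 X : seq 'M[F]_n, basis_of (sl F n) X &
    forall v, v \in X -> exists c : F, ad x v = c *: v.

Definition ad_eigenvalue (F : fieldType) (n : nat) (x : 'M[F]_n) (c : F) :
  Prop := exists z, [/\ z \in sl F n, z != 0 & ad x z = c *: z].

Definition hyperbolic (R : realType) (n : nat) (x : 'M[R]_n) : Prop :=
  [/\ x \in sl R n,
      ad_diagonalizable (cmx x) &
      forall c : R[i], ad_eigenvalue (cmx x) c -> exists mu : R, c = mu%:C].

Definition ad_eigenspace (R : realType) (n : nat) (x : 'M[R]_n) (mu : R) :
  set 'M[R[i]]_n :=
  [set z | z \in sl R[i] n /\ ad (cmx x) z = mu%:C *: z].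

(* The sum of the eigenspaces, as the set of finite sums of their elements;
   eigenspaces for distinct eigenvalues are independent, so it is direct. *)
Definition nilrad (R : realType) (n : nat) (x : 'M[R]_n) : set 'M[R[i]]_n :=
  [set z | exists k : nat, exists mu : 'I_k -> R, exists w : 'I_k -> 'M[R[i]]_n,
     (forall i, 0 < mu i /\ ad_eigenspace x (mu i) (w i)) /\
     z = \sum_(i < k) w i].

(* Subspace closure in sl_n(R): matrices over R carry the product topology. *)
Definition slR_closure (R : realType) (n : nat) (A : set 'M[R]_n) :
  set 'M[R]_n := closure A `&` [set z | z \in sl R n].

Definition orbit_limit (R : realType) (n : nat) (x : 'M[R]_n) : set 'M[R]_n :=
  \bigcap_(eps in [set eps : R | 0 < eps])
    slR_closure (\bigcup_(nu in [set nu : R | 0 < nu < eps]) orbit (nu *: x)).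

(* Polynomial functions on sl_n are the restrictions of the polynomials in the
   n * n matrix entries. *)
Definition zariski_closure (F : fieldType) (n : nat) (A : set 'M[F]_n) :
  set 'M[F]_n :=
  [set z | z \in sl F n /\
     forall p : mpoly.mpoly (n * n) F,
       (forall y, A y -> mpoly.meval (fun k => mxvec y 0 k) p = 0) ->
       mpoly.meval (fun k => mxvec z 0 k) p = 0].

Definition is_richardson_orbit (R : realType) (n : nat) (x : 'M[R]_n)
    (O : set 'M[R[i]]_n) : Prop :=
  [/\ exists2 e, e \in sl R[i] n & O = orbit e,
      O `<=` saturation (nilrad x) &
      saturation (nilrad x) `<=` zariski_closure O].

(* The orbit described by is_richardson_orbit; were there none, it would be
   empty. *)
Definition richardson_orbit (R : realType) (n : nat) (x : 'M[R]_n) :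
  set 'M[R[i]]_n := xget set0 [set O | is_richardson_orbit x O].

Definition real_points (R : realType) (n : nat) (A : set 'M[R[i]]_n) :
  set 'M[R]_n := [set y | y \in sl R n /\ A (cmx y)].

(* Main.v *)
Require Import Defs.
From mathcomp Require Import all_boot all_order all_algebra.
From mathcomp Require Import all_classical all_reals all_analysis.
From mathcomp Require Import complex.
From mathcomp Require Import perm spectral.
From mathcomp Require mpoly.
Import (canonicals, coercions) mpoly.

(** Write x = h D h^-1 with h real invertible and D = diag(d) real. In the
    coordinates given by h, nilrad x is the space u of the matrices w whose
    entry (i, j) vanishes unless d_i > d_j, because this entry spans an
    eigenline of ad D with eigenvalue d_i - d_j. The sets of the theorem are all
    described by the same inequalities on a matrix z:
      rank (z^k) <= #{i | d_i not in t},  for each set t of k distinct scalars.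

    The limit of orbits satisfies them. If z is in the orbit of nu x, the
    product of the z - nu c for c in t is conjugate to a diagonal matrix whose
    rank is at most the right-hand side; as nu tends to 0 and z to y, this
    product tends to the k-th power of y, and the rank cannot jump up in the
    limit (orbit_limit_rank_bounded). The same argument, with an indeterminate in
    place of nu and X D + w in place of z, shows that u satisfies them
    (std_nilrad_rank_bounded).

    Conversely, over any field, a matrix that satisfies the inequalities is
    conjugate to an element of u (rank_bounded_conj_nilrad). One peels off the
    largest value c of d, of multiplicity a: z is restricted to a subspace W of
    codimension a that contains the image of z and is comparable with every
    im z + ker z^k. The rank of the k-th power of the restriction is at most
    rank (z^k) - a or rank (z^(k+1)), and the inequalities for t and for t
    together with c are then exactly those needed on W. As ranks do not change
    from R to C, the real points of G.u are the real matrices of trace 0 that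
    satisfy the inequalities. Such a matrix is g^-1 w g with g real and w in u,
    and it is the limit of the g^-1 (w + nu D) g, which lie in the orbits of the
    nu x since w + nu D is conjugate to nu D (rank_bounded_orbit_limit).

    The inequalities are polynomial, so G.u is Zariski closed, and it remains to
    find an orbit that is dense in it. Let e in u maximize the sum of the ranks
    of its powers. On a line of u through e, all but finitely many points have
    powers of the same ranks as those of e, hence are conjugate to e
    (nilpotent_similar). A polynomial that vanishes on the orbit of e therefore
    vanishes on every such line, and so on u. *)

Set Implicit Arguments.
Unset Strict Implicit.
Unset Printing Implicit Defensive.

Import Order.TTheory GRing.Theory Num.Theory.
Import numFieldNormedType.Exports.

Local Open Scope ring_scope.

(** * Similarity of nilpotent matrices *)

(** Unlike mulmxE, this leaves alone the multiplication inside an iterated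
    product. *)
Lemma mul_mulmx (R : pzSemiRingType) (n : nat) (A B : 'M[R]_n) : A * B = A *m B.
Proof. by []. Qed.

(** Two injections of the same space of columns differ by an automorphism of the
    target. *)
Lemma row_full_transport (F : fieldType) (m r : nat) (A B : 'M[F]_(m, r)) :
  row_full A -> row_full B -> exists2 Y, Y \in unitmx & A = Y *m B.
Proof.
move=> fA fB; have rAB : \rank B^T = \rank A^T.
  by rewrite !mxrank_tr; move: fA fB => /eqP -> /eqP ->.
have [Q Qu AQ] := eq_rank_unitmx rAB.
(* A and Q^T B have the same column space: a base change P of the source
   separates them, and it extends to the target by the identity on the
   complement cut out by 1 - B B^+. *)
have /submxP[P AP] : (A^T <= B^T *m Q)%MS by rewrite AQ.
have defA : A = Q^T *m B *m P^T.
  by rewrite -[A]trmxK AP !trmx_mul trmxK.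
have Pu : P^T \in unitmx.
  rewrite -row_full_unit -sub1mx.
  have /row_fullP[A' A'A] := fA; apply/submxP; exists (A' *m (Q^T *m B)).
  by rewrite -mulmxA -defA.
have /row_fullP[B' B'B] := fB.
pose E := 1%:M - B *m B'.
have EB : E *m B = 0 by rewrite mulmxBl -mulmxA B'B mulmx1 mul1mx subrr.
pose Y := B *m P^T *m B' + E.
have YB : Y *m B = B *m P^T by rewrite mulmxDl EB addr0 -!mulmxA B'B mulmx1.
have Yu : Y \in unitmx.
  have B'E : B' *m E = 0 by rewrite mulmxBr mulmxA B'B mulmx1 mul1mx subrr.
  have EE : E *m E = E by rewrite {1}/E mulmxBl mul1mx -mulmxA B'E mulmx0 subr0.
  apply: (proj1 (mulmx1_unit (B := B *m invmx P^T *m B' + E) _)).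
  rewrite mulmxDr !mulmxA YB -[B *m P^T *m _]mulmxA mulmxV // mulmx1.
  by rewrite /Y mulmxDl EE -[_ *m B' *m E]mulmxA B'E mulmx0 add0r /E addrC subrK.
exists (Q^T *m Y); first by rewrite unitmx_mul unitmx_tr Qu.
by rewrite -mulmxA YB mulmxA.
Qed.

Lemma eqmx_transport (F : fieldType) (m n : nat) (A B : 'M[F]_(m, n)) :
  (A :=: B)%MS -> exists2 Y, Y \in unitmx & A = Y *m B.
Proof.
move=> AB; have [D AD] : exists D, A = D *m row_base B.
  by apply/submxP; rewrite AB eq_row_base.
have fD : row_full D.
  by rewrite /row_full -(mxrankMfree D (row_base_free B)) -AD AB.
have [Y Yu DY] := row_full_transport fD (col_base_full B).
by exists Y; rewrite // AD DY -mulmxA mulmx_base.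
Qed.

(** In a basis whose first r vectors span the image of A, only the first r
    coordinates of an image are nonzero; N is A restricted to its image, and M
    is A on a complement. *)
Lemma block_form (F : fieldType) (r k : nat) (A : 'M[F]_(r + k)) :
  \rank A = r ->
  exists (U : 'M[F]_(r + k)) (N : 'M[F]_r) (M : 'M[F]_(k, r)),
    [/\ U \in unitmx, U *m A = block_mx N 0 M 0 *m U & row_full (col_mx N M)].
Proof.
move=> rA; pose U := row_ebase A; pose X := U *m col_ebase A.
have UA : U *m A = block_mx (ulsubmx X) 0 (dlsubmx X) 0 *m U.
  rewrite -{1}(mulmx_ebase A) !mulmxA rA pid_mx_block -/X -{1}[X]submxK.
  by rewrite mulmx_block !mulmx0 !mulmx1 !addr0.
have Uu : U \in unitmx by apply: row_ebase_unit.
exists U, (ulsubmx X), (dlsubmx X); split => //.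
have rUA : \rank (U *m A) = \rank A by rewrite eqmxMfull ?row_full_unit.
rewrite /row_full -[X in _ == X]rA -rUA UA mxrankMfree ?row_free_unit //.
by rewrite block_mxEh col_mx0 rank_row_mx0.
Qed.

Lemma mulmx_exp_swap (F : fieldType) (m n : nat) (C : 'M[F]_(m, n))
    (P : 'M[F]_(n, m)) (e : nat) :
  (C *m P) ^+ e.+1 = C *m (P *m C) ^+ e *m P.
Proof.
elim: e => [|e IH]; first by rewrite expr0 expr1 mulmx1.
by rewrite exprSr IH [(P *m C) ^+ e.+1]exprSr -!mulmxE !mulmxA.
Qed.

Lemma rank_block_exp (F : fieldType) (r k : nat) (N : 'M[F]_r)
    (M : 'M[F]_(k, r)) (e : nat) :
  row_full (col_mx N M) ->
  \rank ((block_mx N 0 M 0 : 'M[F]_(r + k)) ^+ e.+1) = \rank (N ^+ e).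
Proof.
move=> fNM; pose P := row_mx 1%:M 0 : 'M[F]_(r, r + k).
have -> : block_mx N 0 M 0 = col_mx N M *m P.
  by rewrite mul_mx_row mulmx1 mulmx0 block_mxEh col_mx0.
have PNM : P *m col_mx N M = N by rewrite mul_row_col mul1mx mul0mx addr0.
rewrite mulmx_exp_swap PNM mxrankMfree; last first.
  by rewrite /row_free rank_row_mx0 mxrank1.
by rewrite eqmxMfull.
Qed.

Lemma expmx_conj (F : fieldType) (n : nat) (U A B : 'M[F]_n) (e : nat) :
  U *m A = B *m U -> U *m A ^+ e = B ^+ e *m U.
Proof.
move=> UA; elim: e => [|e IH]; first by rewrite !expr0 mulmx1 mul1mx.
by rewrite exprSr [B ^+ e.+1]exprSr -!mulmxE mulmxA IH -mulmxA UA mulmxA.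
Qed.

Lemma mxrank_conj (F : fieldType) (n : nat) (U A B : 'M[F]_n) :
  U \in unitmx -> U *m A = B *m U -> \rank A = \rank B.
Proof.
move=> Uu UA; rewrite -(eqmxMfull A (A := U)) ?row_full_unit // UA.
by rewrite mxrankMfree ?row_free_unit.
Qed.

(** Modulo the row space of N, the rows of M and of M' span the same space, so an
    invertible Y identifies them there; the remaining error is a combination
    X of the rows of N, which a block triangular conjugation absorbs. *)
Lemma block_similar (F : fieldType) (r k : nat) (N : 'M[F]_r)
    (M M' : 'M[F]_(k, r)) :
  row_full (col_mx N M) -> row_full (col_mx N M') ->
  exists2 g, g \in unitmx & g *m block_mx N 0 M 0 = block_mx N 0 M' 0 *m g.
Proof.
move=> fM fM'; pose C := cokermx N.
have MC (M1 : 'M[F]_(k, r)) : row_full (col_mx N M1) -> (M1 *m C :=: C)%MS.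
  move=> f1; apply: eqmx_trans (eqmxMfull C f1).
  rewrite mul_col_mx mulmx_coker; apply: eqmx_trans _ (addsmxE _ _).
  by apply: eqmx_sym; apply: adds0mx.
have [Y Yu defY] := eqmx_transport (eqmx_trans (MC _ fM') (eqmx_sym (MC _ fM))).
have /submxP[X defX] : (M' - Y *m M <= N)%MS.
  by rewrite submxE mulmxBl defY -mulmxA subrr.
exists (block_mx 1%:M 0 X Y).
  by rewrite unitmxE det_lblock det1 mul1r -unitmxE.
rewrite !mulmx_block !mul1mx !mul0mx !mulmx0 !mulmx1 !addr0.
by rewrite -defX subrK.
Qed.

(** A nilpotent matrix of rank r is determined up to similarity by its
    restriction to its image, whose powers have ranks shifted by one: induction
    on the size applies, and block_similar lifts the similarity back. *)
Lemma nilpotent_similar (F : fieldType) (n : nat) (A B : 'M[F]_n) (m : nat) :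
  A ^+ m = 0 -> (forall e, \rank (A ^+ e) = \rank (B ^+ e)) ->
  exists2 g, g \in unitmx & g *m A = B *m g.
Proof.
elim/ltn_ind: n A B => n IH A B Am rAB.
have := rank_leq_row A; rewrite leq_eqVlt => /orP[/eqP rA | rA].
  have Au : A \in unitmx by rewrite -row_free_unit /row_free rA.
  have n0 : n = 0%N.
    have : A ^+ m \in unitmx.
      by elim: (m) => [|e IHe]; rewrite ?unitmx1 // exprS -mulmxE unitmx_mul Au.
    by rewrite Am -row_free_unit /row_free mxrank0 => /eqP.
  by subst n; exists 1%:M; rewrite ?unitmx1 // [A]flatmx0 [B]flatmx0 mulmx0 mul0mx.
have [r [k [rlt nE rAr]]] : exists r k, [/\ (r < n)%N, n = (r + k)%N & \rank A = r].
  by exists (\rank A), (n - \rank A)%N; split; rewrite ?subnKC // ltnW.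
subst n; have rBr : \rank B = r by rewrite -[B]expr1 -rAB expr1.
have [U [N [M [Uu UA fNM]]]] := block_form rAr.
have [V [N' [M' [Vu VB fNM']]]] := block_form rBr.
have [h hu hN] : exists2 h, h \in unitmx & h *m N = N' *m h.
  apply: IH => //.
    apply/eqP; rewrite -mxrank_eq0 -(rank_block_exp _ fNM).
    rewrite -(mxrank_conj Uu (expmx_conj _ UA)) exprS Am mulr0 mxrank0 //.
  move=> e; rewrite -(rank_block_exp _ fNM) -(rank_block_exp _ fNM').
  rewrite -(mxrank_conj Uu (expmx_conj _ UA)) rAB.
  exact: (mxrank_conj Vu (expmx_conj _ VB)).
pose H := block_mx h 0 0 1%:M : 'M[F]_(r + k).
have Hu : H \in unitmx by rewrite unitmxE det_lblock det1 mulr1 -unitmxE.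
have [g gu gE] : exists2 g, g \in unitmx &
    g *m block_mx N' 0 (M *m invmx h) 0 = block_mx N' 0 M' 0 *m g.
  apply: block_similar => //.
  have -> : col_mx N' (M *m invmx h) = H *m col_mx N M *m invmx h.
    rewrite mul_block_col !mul0mx add0r addr0 mul1mx mul_col_mx hN.
    by rewrite mulmxK.
  rewrite -row_full_unit in hu *.
  rewrite /row_full mxrankMfree ?row_free_unit ?unitmx_inv -?row_full_unit //.
  by rewrite eqmxMfull ?row_full_unit.
have HB : H *m block_mx N 0 M 0 = block_mx N' 0 (M *m invmx h) 0 *m H.
  by rewrite !mulmx_block !mulmx0 !mul0mx !addr0 !add0r mul1mx hN mulmxKV.
exists (invmx V *m (g *m (H *m U))).
  by rewrite !unitmx_mul unitmx_inv Vu gu Hu.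
apply: (can_inj (mulKmx Vu)); rewrite !mulmxA VB mulmxV // mul1mx.
rewrite -!mulmxA [V *m _]mulmxA mulmxV // mul1mx UA.
by rewrite (mulmxA H) HB !mulmxA gE.
Qed.

(** * Nilradicals of standard parabolics and the rank inequalities *)

Lemma submx_between (F : fieldType) (n p : nat) (A B : 'M[F]_n) :
  (A <= B)%MS -> (\rank A <= p <= \rank B)%N ->
  exists W : 'M[F]_n, [/\ (A <= W)%MS, (W <= B)%MS & \rank W = p].
Proof.
move=> AB /andP[/subnKC <-]; move: (p - _)%N => j {p}.
elim: j A AB => [|j IH] A AB; first by exists A; rewrite addn0.
rewrite addnS => ltB.
have /row_subPn[i iA] : ~~ (B <= A)%MS.
  by apply: contraTN ltB => /mxrankS BA; rewrite -leqNgt (leq_trans BA) ?leq_addr.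
pose A' := (A + row i B)%MS.
have rA' : \rank A' = (\rank A).+1.
  apply/eqP; rewrite eqn_leq; apply/andP; split.
    by rewrite (leq_trans (mxrank_adds_leqif _ _)) // -[leqRHS]addn1 leq_add2l rank_leq_row.
  by rewrite rank_ltmx // /ltmx addsmxSl /= addsmx_sub submx_refl.
have A'B : (A' <= B)%MS by rewrite addsmx_sub AB row_sub.
have [|W [A'W WB rW]] := IH A' A'B; first by rewrite rA' addSn.
exists W; rewrite WB rW rA' addSn; split => //.
by apply: submx_trans A'W; apply: addsmxSl.
Qed.

(** A subspace of prescribed dimension can be chosen to be nested with a whole
    increasing chain: it fits between two consecutive members of it. *)
Lemma submx_chain (F : fieldType) (n p m : nat) (U : nat -> 'M[F]_n) :
  (forall k, U k <= U k.+1)%MS -> row_full (U m) ->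
  (\rank (U 0%N) <= p <= n)%N ->
  exists W : 'M[F]_n, [/\ \rank W = p, (U 0%N <= W)%MS &
    forall k, (U k <= W)%MS \/ (W <= U k)%MS].
Proof.
move=> Uk fU /andP[U0 pn].
have Umono i j : (i <= j)%N -> (U i <= U j)%MS.
  by move/subnKC <-; elim: (j - i)%N => [|e IH]; rewrite ?addn0 // addnS (submx_trans IH).
have ex : exists k, (p <= \rank (U k))%N by exists m; rewrite (eqP fU).
case: (ex_minnP ex) => [[|k] pU kmin].
  exists (U 0%N); split=> //; first by apply/eqP; rewrite eqn_leq U0.
  by move=> k; right; apply: Umono.
have ltk : (\rank (U k) < p)%N by rewrite ltnNge; apply/negP => /kmin; rewrite ltnn.
have [|W [kW Wk rW]] := submx_between (Uk k) (p := p); first by rewrite ltnW.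
exists W; split => //; first exact: submx_trans (Umono _ _ (leq0n k)) kW.
move=> i; case: (leqP i k) => ik; first by left; apply: submx_trans (Umono _ _ ik) kW.
by right; apply: submx_trans Wk (Umono _ _ ik).
Qed.

(** W is chosen nested with the spaces im z + ker z^k. If W contains the k-th of
    them, then z^k loses on W as much rank as W has codimension; if W is
    contained in it, then z^k maps W into the image of z^(k+1). *)
Lemma peel_subspace (F : fieldType) (n p m : nat) (z : 'M[F]_n) :
  z ^+ m = 0 -> (\rank z <= p <= n)%N ->
  exists W : 'M[F]_n, [/\ \rank W = p, (z <= W)%MS &
    forall k, (\rank (W *m z ^+ k) + n <= \rank (z ^+ k) + p)%N \/
              (\rank (W *m z ^+ k) <= \rank (z ^+ k.+1))%N].
Proof.
move=> zm rzp; pose U k := (z + kermx (z ^+ k))%MS.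
have Uk k : (U k <= U k.+1)%MS.
  apply: addsmxS => //; apply/sub_kermxP.
  by rewrite exprSr -mulmxE mulmxA mulmx_ker mul0mx.
have fU : row_full (U m).
  rewrite -sub1mx; apply: submx_trans (addsmxSr _ _); apply/sub_kermxP.
  by rewrite zm mulmx0.
have U0 : (U 0%N :=: z)%MS.
  have -> : U 0%N = (z + kermx 1%:M)%MS by [].
  have -> : kermx (1%:M : 'M[F]_n) = 0.
    by apply/eqP; rewrite kermx_eq0 row_free_unit unitmx1.
  exact: addsmx0.
have [|W [rW zW WU]] := submx_chain (p := p) Uk fU; first by rewrite U0.
exists W; split; rewrite -?U0 //.
move=> k; case: (WU k) => [UW|{}WU]; [left | right].
  have kW : (kermx (z ^+ k) <= W)%MS by apply: submx_trans UW; apply: addsmxSr.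
  have := mxrank_mul_ker W (z ^+ k); have /eqmxP/eqmx_rank -> := capmx_idPr kW.
  rewrite mxrank_ker rW => <-.
  by rewrite [leqRHS]addnCA leq_add2l subnKC // rank_leq_row.
apply: mxrankS; apply: submx_trans (submxMr _ WU) _.
by rewrite addsmxMr addsmx_sub mulmx_ker sub0mx exprS -mulmxE submx_refl.
Qed.

(** The nilradical of the standard parabolic subalgebra attached to diag(d): the
    entry (i, j) spans an eigenline of ad diag(d) with eigenvalue d_i - d_j. No
    ordering of the indices is imposed, so that d need not be sorted. *)
Definition std_nilrad (F : fieldType) (T : realDomainType) (n : nat)
  (d : 'I_n -> T) (w : 'M[F]_n) := forall i j, w i j != 0 -> d j < d i.

(** For each size k the sharpest inequality is that of the k values of d of
    largest multiplicities, and these are the inequalities on ranks of powers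
    that describe the closure of a nilpotent orbit. Quantifying over all t makes
    the family stable under the removal of a value of d, whatever its
    multiplicity. *)
Definition rank_bounded (F : fieldType) (T : realDomainType) (n : nat)
    (d : 'I_n -> T) (z : 'M[F]_n) :=
  forall t : seq T, uniq t ->
    (\rank (z ^+ size t) <= #|[pred i | d i \notin t]|)%N.

Lemma sorted_nseq_cat (T : realDomainType) (c : T) (s : seq T) :
  sorted >=%R (c :: s) ->
  c :: s = nseq (count_mem c (c :: s)) c ++ [seq e <- c :: s | e != c].
Proof.
elim: s c => [|e s IH] c /=; first by rewrite eqxx.
rewrite eqxx /= => /andP[ec es].
case: (eqVneq e c) => [ec'|nec] /=.
  by subst e; have := IH c es; rewrite /= eqxx /= => {1}->.
have -> : count_mem c s = 0%N.
  apply/count_memPn/negP => cs; have := order_path_min ge_trans es.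
  move/allP/(_ _ cs) => /= ce; move: nec; rewrite eq_le ec ce //.
rewrite /=; congr [:: c, e & _]; apply/esym/all_filterP/allP => f fs.
apply: contraNneq nec => fc; rewrite eq_le ec /= -fc.
by have /allP/(_ _ fs) := order_path_min ge_trans es.
Qed.

Lemma row_base_of (F : fieldType) (m n p : nat) (W : 'M[F]_(m, n)) :
  \rank W = p -> exists2 B : 'M[F]_(p, n), row_free B & (B :=: W)%MS.
Proof.
by case: p /; exists (row_base W); rewrite ?row_base_free //; apply: eq_row_base.
Qed.

(** Induction that peels off the largest value c of d, of multiplicity a. The
    restriction z' of z to the subspace of peel_subspace satisfies the
    inequalities for the other values: those of z at t and at c :: t bound the
    two ranks between which peel_subspace leaves the choice. A complement of the
    subspace is put in front to obtain the block of c. *)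
Lemma rank_bounded_seq (F : fieldType) (T : realDomainType) (n : nat)
    (ds : seq T) (z : 'M[F]_n) :
  size ds = n -> sorted >=%R ds ->
  (forall t : seq T, uniq t ->
    (\rank (z ^+ size t) <= count [pred c | c \notin t] ds)%N) ->
  exists g, exists w, [/\ g \in unitmx, g *m z = w *m g &
    forall i j, w i j != 0 -> nth 0 ds j < nth 0 ds i].
Proof.
elim/ltn_ind: n ds z => n IH [|c s] z szn srt rz.
  move: szn => /= n0; subst n; exists 1%:M, 0.
  by split; [exact: unitmx1 | rewrite [z]flatmx0 mul0mx mulmx0 | case].
have := sorted_nseq_cat srt.
set a := count_mem c _; set ds' := [seq e <- _ | _].
set ds := c :: s in szn srt rz * => dsE.
have a0 : (0 < a)%N by rewrite /a /= eqxx.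
have ds'c e : e \in ds' -> e < c.
  rewrite mem_filter => /andP[/negPf ec]; rewrite inE ec /= => es.
  by have /allP/(_ _ es) := order_path_min ge_trans srt; rewrite /= le_eqVlt ec.
have nE : n = (a + size ds')%N by rewrite -szn dsE size_cat size_nseq.
set p := size ds' in nE; clear szn; subst n.
have zm : z ^+ size (undup ds) = 0.
  apply/eqP; rewrite -mxrank_eq0 -leqn0 (leq_trans (rz _ (undup_uniq _))) //.
  rewrite leqn0 -[_ == _]negbK -lt0n -has_count; apply/hasPn => e eds.
  by rewrite inE mem_undup eds.
have countc (t : seq T) : c \notin t ->
    count [pred e | e \notin t] ds = (a + count [pred e | e \notin t] ds')%N.
  by move=> ct; rewrite {1}dsE count_cat count_nseq /= ct mul1n.
have countct t : count [pred e | e \notin c :: t] ds = count [pred e | e \notin t] ds'.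
  rewrite {1}dsE count_cat count_nseq /= inE eqxx mul0n add0n.
  apply: eq_in_count => e /ds'c /lt_eqF; rewrite /= inE => -> //.
have [|W [rW zW Wz]] := peel_subspace (p := p) zm.
  rewrite leq_addl andbT -[z]expr1 (leq_trans (rz [:: c] isT)) //.
  by rewrite countct (leq_trans (count_size _ _)).
have [B fB BW] := row_base_of rW.
have /submxP[y zE] : (z <= B)%MS by rewrite BW.
(* z = y B factors through W, and z' is the matrix of z on W in the basis B. *)
pose z' := B *m y.
have Bz : B *m z = z' *m B by rewrite zE mulmxA.
have Bzk k : B *m z ^+ k = z' ^+ k *m B.
  elim: k => [|k IHk]; first by rewrite !expr0 mulmx1 mul1mx.
  by rewrite exprSr [z' ^+ k.+1]exprSr -!mulmxE mulmxA IHk -mulmxA Bz mulmxA.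
have rz' k : \rank (z' ^+ k) = \rank (W *m z ^+ k).
  by rewrite -(mxrankMfree _ fB) -Bzk (eqmxMr _ BW).
have bound0 t : uniq t -> c \notin t ->
    (\rank (z' ^+ size t) <= count [pred e | e \notin t] ds')%N.
  move=> ut ct; rewrite rz'; case: (Wz (size t)) => [h | h].
    rewrite -(leq_add2r (a + p)) (leq_trans h) // addnA leq_add2r [leqRHS]addnC -countc //.
    exact: rz.
  apply: (leq_trans h); rewrite -countct; apply: (rz (c :: t)).
  by rewrite /= ct.
have [|||t ut|g' [w' [g'u g'z w'E]]] := IH p _ ds' z'.
- by rewrite -addn1 addnC leq_add2r.
- by [].
- exact: sorted_filter ge_trans _ _ srt.
(* A power indexed by t has at most the rank of the one indexed by t minus c. *)
- pose t0 := [seq e <- t | e != c].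
  have lt0 : (size t0 <= size t)%N by rewrite size_filter count_size.
  rewrite -(subnKC lt0) exprD -mulmxE.
  apply: leq_trans (mxrankM_maxl _ _) _; apply: leq_trans (bound0 t0 _ _) _.
  + by rewrite filter_uniq.
  + by rewrite mem_filter eqxx.
  rewrite leq_eqVlt; apply/orP; left; apply/eqP; apply: eq_in_count => e /ds'c /lt_eqF ec.
  by rewrite /= mem_filter ec.
have rBc : \rank (B^C)%MS = a.
  by rewrite mxrank_compl (eqP fB) addnK.
have [C fC CB] := row_base_of rBc.
exists (col_mx C (g' *m B)), (block_mx 0 (C *m y *m invmx g') 0 w'); split.
- rewrite -row_full_unit -sub1mx -addsmxE.
  apply: submx_trans (_ : B + B^C <= _)%MS; first by rewrite sub1mx addsmx_compl_full.
  by rewrite addsmxC addsmxS // ?CB // eqmxMfull ?row_full_unit.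
- rewrite mul_col_mx mul_block_col !mul0mx !add0r -(mulmxA g' B z) Bz (mulmxA g' z' B) g'z.
  by rewrite !mulmxA mulmxKV // {1}zE !mulmxA.
move=> i j; rewrite dsE !nth_cat !size_nseq.
case: (split_ordP i) => i' ->; case: (split_ordP j) => j' -> /=.
- by rewrite block_mxEul mxE eqxx.
- rewrite !nth_nseq ltn_ord => _.
  by rewrite addKn; apply: ds'c; rewrite mem_nth.
- by rewrite block_mxEdl mxE eqxx.
- by rewrite block_mxEdr !addKn; apply: w'E.
Qed.

(** The sorted case is transported along a permutation of the indices. *)
Lemma rank_bounded_conj_nilrad (F : fieldType) (T : realDomainType) (n : nat)
    (d : 'I_n -> T) (z : 'M[F]_n) :
  rank_bounded d z ->
  exists g, exists w, [/\ g \in unitmx, g *m z = w *m g & std_nilrad d w].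
Proof.
move=> rz; pose ts := [tuple d i | i < n].
have szs : size (sort >=%R ts) = n by rewrite size_sort size_tuple.
have /tuple_permP[s sE] : perm_eq (Tuple (introT eqP szs)) ts by rewrite /= perm_sort.
have nthE (i : 'I_n) : nth 0 (sort >=%R ts) i = d (s i).
  have -> : sort >=%R ts = [tuple tnth ts (s i) | i < n] by rewrite -sE.
  by rewrite -tnth_nth !tnth_mktuple.
have [|t ut|g [w [gu gz wE]]] := @rank_bounded_seq F T n (sort >=%R ts) z szs.
- exact: (sort_sorted (@ge_total _ T)).
- apply: (leq_trans (rz t ut)); rewrite count_sort.
  rewrite /ts /= count_map cardE size_filter enumT.
  by apply/eq_leq/eq_count.
pose P := perm_mx s^-1 : 'M[F]_n.
have sP : perm_mx s *m P = 1%:M by rewrite -perm_mxM mulgV perm_mx1.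
exists (P *m g), (P *m w *m perm_mx s); split.
- by rewrite unitmx_mul unitmx_perm.
- by rewrite -(mulmxA P g z) gz !mulmxA -(mulmxA (P *m w) _ P) sP mulmx1.
move=> i j h; have {}h : w (s^-1%g i) (s^-1%g j) != 0.
  apply: contraNneq h; rewrite -row_permE -[X in _ *m perm_mx X]invgK -col_permE !mxE => ->.
  exact: eqxx.
by have := wE _ _ h; rewrite !nthE !permKV.
Qed.

(** * Perturbing a diagonal matrix by its nilradical *)

(** At a nonzero coordinate of a vector of the kernel, chosen with d minimal, the
    equation reduces to its diagonal term. *)
Lemma graded_unitmx (F : fieldType) (T : realDomainType) (n : nat)
    (d : 'I_n -> T) (A : 'M[F]_n) :
  (forall i, A i i != 0) ->
  (forall i k, i != k -> A i k != 0 -> d k < d i) -> A \in unitmx.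
Proof.
move=> Adiag Alow; rewrite -unitmx_tr -row_free_unit; apply: inj_row_free => v vA.
apply/eqP/negPn/negP => /rV0Pn[i0 vi0].
case: (@Order.TotalTheory.arg_minP _ _ _ i0 (fun i => v 0 i != 0) d vi0) => i vi imin.
have /eqP := congr1 (fun M : 'rV_n => M 0 i) vA; rewrite !mxE (bigD1 i) //= big1 => [|k ki].
  by rewrite addr0 mxE mulf_eq0 (negPf vi) (negPf (Adiag i)).
rewrite mxE; case: (eqVneq (A i k) 0) => [->|Aik]; first by rewrite mulr0.
case: (eqVneq (v 0 k) 0) => [->|vk]; first by rewrite mul0r.
have := imin k vk; rewrite leNgt Alow // eq_sym //.
Qed.

(** The conjugating matrix is 1 + v with v in the nilradical. The equation on v
    decouples into one linear system for each column j, with matrix A j; it is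
    invertible because it is triangular for d with diagonal coefficients
    e_j - e_i where d_j < d_i, and 1 elsewhere. *)
Lemma diag_add_nilrad_conj (F : fieldType) (T : realDomainType) (n : nat)
    (d : 'I_n -> T) (e : 'rV[F]_n) (w : 'M[F]_n) :
  (forall i j, d j < d i -> e 0 i != e 0 j) -> std_nilrad d w ->
  exists2 g, g \in unitmx & (diag_mx e + w) *m g = g *m diag_mx e.
Proof.
move=> e_sep uw.
pose A j := \matrix_(i, k) (if d j < d i then (e 0 j - e 0 i) *+ (i == k) - w i k
                            else (i == k)%:R) : 'M[F]_n.
have wii i k : ~~ (d k < d i) -> w i k = 0.
  by move=> h; apply/eqP; apply: contraNT h; apply: uw.
have Au j : A j \in unitmx.
  apply: (@graded_unitmx _ _ _ d) => [i|i k ik]; rewrite !mxE.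
    rewrite eqxx (wii i i) ?ltxx // subr0; case: ifP => [ji|_]; last exact: oner_neq0.
    by rewrite mulr1n subr_eq0 eq_sym e_sep.
  rewrite (negPf ik) mulr0n sub0r; case: ifP => _; last by rewrite eqxx.
  by rewrite oppr_eq0; apply: uw.
pose v := \matrix_(i, j) (invmx (A j) *m col j w) i 0 : 'M[F]_n.
have Av j i : \sum_k A j i k * v k j = w i j.
  have /(congr1 (fun M : 'cV_n => M i 0)) := mulKVmx (Au j) (col j w).
  by rewrite !mxE => <-; apply: eq_bigr => k _; rewrite [v k j]mxE.
have v0 i j : ~~ (d j < d i) -> v i j = 0.
  move=> ji; have := Av j i; rewrite (wii _ _ ji) (bigD1 i) //= big1 => [|k ki].
    by rewrite mxE (negPf ji) eqxx mul1r addr0.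
  by rewrite mxE (negPf ji) eq_sym (negPf ki) mul0r.
clearbody v; exists (1%:M + v).
  apply: (@graded_unitmx _ _ _ d) => [i|i k ik]; rewrite 2!mxE.
    by rewrite eqxx v0 ?ltxx // addr0 oner_neq0.
  by rewrite (negPf ik) add0r; apply: contraTT => /v0 ->; rewrite eqxx.
rewrite mulmxDr mulmx1 !mulmxDl mul1mx.
rewrite -addrA; congr (_ + _).
apply/matrixP => i j; rewrite mul_diag_mx mul_mx_diag !mxE.
case: (boolP (d j < d i)) => ji; last first.
  rewrite v0 // wii // mulr0 mul0r !add0r big1 // => k _.
  case: (boolP (d k < d i)) => [ki|/wii ->]; last by rewrite mul0r.
  rewrite v0 ?mulr0 //; apply: contraNN ji => jk; exact: lt_trans ki.
have : w i j + \sum_k w i k * v k j = (e 0 j - e 0 i) * v i j.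
  rewrite -[X in X + _ = _](Av j i) -big_split /= (bigD1 i) //= big1 => [|k ki].
    by rewrite mxE ji eqxx mulr1n addr0 -mulrDl subrK.
  by rewrite mxE ji eq_sym (negPf ki) mulr0n sub0r mulNr addNr.
rewrite mulrBl => /eqP; rewrite eq_sym subr_eq => /eqP h.
by rewrite [RHS]mulrC h -addrA; congr (_ + _); rewrite addrC.
Qed.

Lemma std_nilrad_diag (F : fieldType) (T : realDomainType) (n : nat)
    (d : 'I_n -> T) (a b : 'rV[F]_n) (w : 'M[F]_n) :
  std_nilrad d w -> std_nilrad d (diag_mx a *m w *m diag_mx b).
Proof.
move=> uw i j; rewrite mul_mx_diag mul_diag_mx !mxE => h; apply: uw.
by apply: contraNneq h => ->; rewrite mulr0 mul0r.
Qed.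

(** A certificate of large rank through constant matrices: the determinants
    det (P A Q) play the role of the minors of A. *)
Lemma mxrank_geP (F : fieldType) (m n r : nat) (A : 'M[F]_(m, n)) :
  reflect (exists P : 'M[F]_(r, m), exists Q : 'M[F]_(n, r), P *m A *m Q = 1%:M)
    (r <= \rank A)%N.
Proof.
apply: (iffP idP) => [rA | [P [Q PAQ]]]; last first.
  rewrite -(mxrank1 F r) -PAQ.
  exact: leq_trans (mxrankM_maxl _ _) (mxrankM_maxr _ _).
exists (pid_mx r *m invmx (col_ebase A)), (invmx (row_ebase A) *m pid_mx r).
rewrite -{2}(mulmx_ebase A) !mulmxA mulmxKV ?col_ebase_unit //.
rewrite mulmxK ?row_ebase_unit // !mul_pid_mx.
have [rm rn] := (leq_trans rA (rank_leq_row A), leq_trans rA (rank_leq_col A)).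
by rewrite (minn_idPl rA) (minn_idPr rm) minnn (minn_idPr rn) pid_mx_1.
Qed.

Lemma det_neq0_rank (F : fieldType) (m n r : nat) (A : 'M[F]_(m, n))
    (P : 'M[F]_(r, m)) (Q : 'M[F]_(n, r)) :
  \det (P *m A *m Q) != 0 -> (r <= \rank A)%N.
Proof.
rewrite -unitfE -unitmxE -row_free_unit => /eqP {1}<-.
exact: leq_trans (mxrankM_maxl _ _) (mxrankM_maxr _ _).
Qed.

(** Lower semicontinuity of the rank along a polynomial curve of matrices. *)
Lemma rank_horner_generic (F : fieldType) (n r : nat) (A : 'M[{poly F}]_n) (t0 : F) :
  (r <= \rank (map_mx (horner_eval t0) A))%N ->
  exists2 p : {poly F}, p.[t0] != 0 &
    forall t, p.[t] != 0 -> (r <= \rank (map_mx (horner_eval t) A))%N.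
Proof.
move=> /mxrank_geP[P [Q PQ]].
pose p := \det (map_mx polyC P *m A *m map_mx polyC Q).
have pE t : p.[t] = \det (P *m map_mx (horner_eval t) A *m Q).
  rewrite -[LHS]/(horner_eval t p) /p -det_map_mx !map_mxM -!map_mx_comp.
  by congr (\det (_ *m _ *m _)); apply/matrixP => i j; rewrite !mxE /= horner_evalE hornerC.
exists p => [|t]; rewrite pE; first by rewrite PQ det1 oner_neq0.
exact: det_neq0_rank.
Qed.

Lemma poly_nonroot (F : numFieldType) (p : {poly F}) : p != 0 -> exists t, p.[t] != 0.
Proof.
move=> p0; pose s := [seq i%:R : F | i <- iota 0 (size p)].
have /allPn[t _ pt] : ~~ all (root p) s.
  apply/negP => /max_poly_roots-/(_ p0); rewrite size_map size_iota ltnn.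
  by rewrite map_inj_uniq ?iota_uniq => [/(_ isT)//|i j /eqP]; rewrite eqr_nat => /eqP.
by exists t.
Qed.

Lemma shifted_prod_conj (F : fieldType) (I : Type) (n : nat) (U A B : 'M[F]_n)
    (s : seq I) (a : I -> F) :
  U *m A = B *m U ->
  U *m (\prod_(c <- s) (A - (a c)%:M)) = (\prod_(c <- s) (B - (a c)%:M)) *m U.
Proof.
move=> UA; elim: s => [|c s IH]; first by rewrite !big_nil mulmx1 mul1mx.
rewrite !big_cons !mul_mulmx mulmxA mulmxBr UA scalar_mxC -mulmxBl.
by rewrite -[LHS]mulmxA IH mulmxA.
Qed.

Lemma rank_diag_prod (F : fieldType) (T : realDomainType) (n : nat)
    (d : 'I_n -> T) (e : 'rV[F]_n) (s : seq T) (a : T -> F) :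
  (forall i, e 0 i = a (d i)) ->
  (\rank (\prod_(c <- s) (diag_mx e - (a c)%:M))%R <= #|[pred i | d i \notin s]|)%N.
Proof.
move=> ea.
have -> : \prod_(c <- s) (diag_mx e - (a c)%:M) =
    diag_mx (\row_i \prod_(c <- s) (e 0 i - a c)).
  elim: s => [|c s IH].
    rewrite big_nil; apply/matrixP => i j; rewrite !mxE big_nil //.
  rewrite big_cons IH mul_mulmx; apply/matrixP => i j.
  rewrite mulmxBl mul_scalar_mx mul_diag_mx !mxE big_cons mulrnAr mulrnAr.
  by rewrite -mulrnBl -mulrBl.
set m := \row_i _; have mE i : d i \in s -> m 0 i = 0.
  by move=> si; rewrite mxE (big_rem _ si) /= ea subrr mul0r.
rewrite diag_mx_sum_delta (bigID (fun i => d i \in s)) /= big1 ?add0r; last first.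
  by move=> i si; rewrite mE // scale0r.
rewrite -sum1_card; apply: (big_ind2 (fun (M : 'M[F]_n) k => \rank M <= k)%N).
- by rewrite mxrank0.
- by move=> M k M' k' h h'; apply: leq_trans (mxrank_add _ _) (leq_add h h').
- move=> i _; rewrite -(mul_delta_mx (0 : 'I_1)) scalemxAr.
  exact: leq_trans (mxrankM_maxr _ _) (rank_leq_row _).
Qed.

(** For s <> 0 the matrix s D + w is conjugate to s D, so that the product of the
    s D + w - s c over c in t has the rank of a diagonal matrix. By
    semicontinuity the bound persists at s = 0, where the product is a power
    of w. *)
Lemma std_nilrad_rank_bounded (F : numFieldType) (T : realDomainType)
    (f : T -> F) (n : nat) (d : 'I_n -> T) (w : 'M[F]_n) :
  injective f -> std_nilrad d w -> rank_bounded d w.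
Proof.
move=> f_inj uw t ut; rewrite leqNgt; apply/negP => ltr.
pose e : 'rV[F]_n := \row_i f (d i).
pose A : 'M[{poly F}]_n := \prod_(c <- t)
   ('X *: map_mx polyC (diag_mx e) + map_mx polyC w - ('X * (f c)%:P)%:M).
have AE s : map_mx (horner_eval s) A =
    \prod_(c <- t) (s *: diag_mx e + w - (s * f c)%:M).
  rewrite /A; elim: (t) => [|c t' IH]; first by rewrite !big_nil map_mx1.
  rewrite !big_cons !mul_mulmx map_mxM IH; congr (_ *m _).
  apply/matrixP => i j; rewrite !mxE /= horner_evalE !hornerE.
  by case: (i == j); rewrite ?mulr1n ?mulr0n ?hornerE // ?oppr0 ?addr0.
have A0 : map_mx (horner_eval 0) A = w ^+ size t.
  rewrite AE; elim: (t) => [|c t' IH]; first by rewrite big_nil.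
  by rewrite big_cons IH exprS mul0r scale0r add0r raddf0 subr0.
rewrite -A0 in ltr; have [p p0 pE] := rank_horner_generic ltr.
have [s] : exists s, (p * 'X).[s] != 0.
  apply: poly_nonroot; rewrite mulf_eq0 polyX_eq0 orbF.
  by apply: contraNneq p0 => ->; rewrite horner0.
rewrite hornerM hornerX mulf_eq0 negb_or => /andP[/pE + s0].
rewrite AE leqNgt ltnS => /negP; apply.
have [|g gu gE] := @diag_add_nilrad_conj _ _ _ d (s *: e) w _ uw.
  move=> i j ji; rewrite !mxE; apply: contraTneq ji => /(mulfI s0)/f_inj ->.
  by rewrite ltxx.
have sE : s *: diag_mx e = diag_mx (s *: e).
  by apply/matrixP => i j; rewrite !mxE mulrnAr.
rewrite sE -(mxrankMfree _ (_ : row_free g)) ?row_free_unit //.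
rewrite -(shifted_prod_conj _ _ (esym gE)).
apply: leq_trans (mxrankM_maxr _ _) _.
by apply: rank_diag_prod => i; rewrite !mxE.
Qed.

Local Open Scope classical_set_scope.
Local Open Scope complex_scope.

(** * Real diagonalization of hyperbolic elements *)

Lemma seq_choice (A : eqType) (B : eqType) (X : seq A) (P : A -> B -> Prop) :
  (forall v, v \in X -> exists r, P v r) ->
  exists rs : seq B, forall v, v \in X -> exists2 r, r \in rs & P v r.
Proof.
elim: X => [|v X IH] H; first by exists [::].
have [|rs rsE] := IH; first by move=> u uX; apply: H; rewrite inE uX orbT.
have [r Pr] := H v (mem_head _ _).
exists (r :: rs) => u; rewrite inE => /orP[/eqP -> | /rsE [q qrs Pq]].
  by exists r; rewrite ?mem_head.
by exists q; rewrite // inE qrs orbT.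
Qed.

Section AdProduct.
Variables (F : fieldType) (n : nat) (x : 'M[F]_n).

(** The product of the commuting operators ad x - c, for c in s. *)
Definition ad_prod (s : seq F) (z : 'M[F]_n) :=
  foldr (fun c y => ad x y - c *: y) z s.

Lemma ad_prodD s a z z' : ad_prod s (a *: z + z') = a *: ad_prod s z + ad_prod s z'.
Proof.
elim: s => [|c s IH] //=; rewrite {}IH /ad mulmxDr mulmxDl -scalemxAr -scalemxAl.
move: (ad_prod s z) (ad_prod s z') => u v.
rewrite !scalerDr !scalerN !scalerA (mulrC c a) !opprD !addrA.
rewrite -!addrA; congr (_ + _); rewrite addrCA; congr (_ + _).
by rewrite addrA addrACA -!addrA addrCA.
Qed.

Lemma ad_prod0 s : ad_prod s 0 = 0.
Proof. by elim: s => //= c s ->; rewrite /ad mulmx0 mul0mx scaler0 !subr0. Qed.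

Lemma ad_prod_eigen s r v : r \in s -> ad x v = r *: v -> ad_prod s v = 0.
Proof.
move=> rs vr; have vE t : exists a, ad_prod t v = a *: v.
  elim: t => [|c t [a IH]]; first by exists 1; rewrite scale1r.
  exists (a * (r - c)); rewrite /= IH /ad -scalemxAr -scalemxAl -scalerBr.
  by rewrite -/(ad x v) vr !scalerA -scalerBl mulrBr (mulrC c).
case/splitPr: rs => s1 s2; rewrite /ad_prod foldr_cat -/(ad_prod _ _).
have [a /= vs2] := vE s2; rewrite -/(ad_prod s2 v) vs2 /ad -scalemxAr -scalemxAl -scalerBr.
by rewrite -/(ad x v) vr scalerA (mulrC r) -scalerA subrr -[RHS](ad_prod0 s1).
Qed.

(** For a left eigenvector u of x with eigenvalue l, the matrices f u form an
    ad x-stable copy of the column space on which ad x acts as x - l. *)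
Lemma ad_prod_rank1 s (l : F) (f : 'cV[F]_n) (u : 'rV[F]_n) :
  u *m x = l *: u ->
  ad_prod s (f *m u) = (\prod_(c <- s) (x - (l + c)%:M)) *m f *m u.
Proof.
move=> ul; elim: s => [|c s IH]; first by rewrite big_nil mul1mx.
rewrite big_cons mul_mulmx /= -/(ad_prod s _) {}IH /ad -!mulmxA ul.
rewrite -!scalemxAr !mulmxA !mulmxBl mul_scalar_mx -!scalemxAl.
by rewrite scalerDl opprD addrA.
Qed.

End AdProduct.

(** The product of the ad x - c kills sl_n by diagonalizability of ad x, and it
    kills the scalar matrices because 0 is one of the c; hence it kills all
    matrices, in particular those of ad_prod_rank1, whence an annihilating
    polynomial of x. *)
Lemma ad_diag_annihilator (F : fieldType) (n : nat) (x : 'M[F]_n) (l : F)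
   (u : 'rV[F]_n) (s : seq F) (X : seq 'M[F]_n) :
  n%:R != 0 :> F ->
  u != 0 -> u *m x = l *: u -> basis_of (sl F n) X ->
  (forall v, v \in X -> exists2 r, r \in s & ad x v = r *: v) ->
  0 \in s -> \prod_(c <- s) (x - (l + c)%:M) = 0.
Proof.
move=> n0 u0 ul Xb Xs s0.
have sl0 z : z \in sl F n -> ad_prod x s z = 0.
  move=> /(coord_basis (X := in_tuple X) Xb) ->.
  elim/big_rec: _ => [|i y _ IH]; first exact: ad_prod0.
  rewrite ad_prodD IH addr0.
  have [r rs Xr] := Xs _ (mem_nth 0 (ltn_ord i)).
  by rewrite (ad_prod_eigen rs Xr) scaler0.
have all0 z : ad_prod x s z = 0.
  rewrite -[z](subrK ((\tr z / n%:R) *: 1%:M)) addrC ad_prodD [X in _ + X]sl0.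
    rewrite (ad_prod_eigen s0) ?scaler0 ?addr0 //.
    by rewrite /ad mulmx1 mul1mx subrr scale0r.
  by rewrite mem_sl linearB linearZ /= mxtrace1 divfK // subrr.
have /rV0Pn[j uj] := u0.
apply/matrixP => i k; have := all0 (delta_mx k 0 *m u).
rewrite (ad_prod_rank1 _ _ ul) -colE.
move=> /matrixP/(_ i j); rewrite !mxE big_ord1 !mxE => /eqP.
by rewrite mulf_eq0 (negPf uj) orbF => /eqP.
Qed.

(** By ad_diag_annihilator, x is annihilated over C by a product of x - (l + c)
    with distinct real c, where l is one eigenvalue. The conjugate of l is also
    an eigenvalue of the real matrix x, so it differs from l by a real number,
    and l is real. The annihilating polynomial is then real with simple
    roots. *)
Lemma hyperbolic_diag (R : realType) (n : nat) (x : 'M[R]_n) :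
  (0 < n)%N -> hyperbolic x ->
  exists2 h, h \in unitmx & exists d : 'rV[R]_n, x *m h = h *m diag_mx d.
Proof.
case: n x => // n x _ [xsl [X Xb Xad] xreal].
have [rs rsE] : exists rs : seq R, forall v, v \in X ->
    exists2 r, r \in rs & ad (cmx x) v = r%:C *: v.
  apply: seq_choice => v vX; have [c vc] := Xad v vX.
  have [|r rE] := xreal c; last by exists r; rewrite vc rE.
  exists v; split => //; first exact: basis_mem Xb vX.
  exact: free_not0 (basis_free Xb) vX.
pose s := undup (0 :: rs).
have sE v : v \in X -> exists2 r, r \in map (real_complex R) s & ad (cmx x) v = r *: v.
  move=> /rsE[r rrs vr]; exists r%:C => //; apply: map_f.
  by rewrite mem_undup inE rrs orbT.
have s0 : 0 \in map (real_complex R) s.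
  by apply/mapP; exists 0; rewrite ?mem_undup ?mem_head // rmorph0.
have [l /eigenvalueP[u ul u0]] := eigenvalue_closed (cmx x) (ltn0Sn n).
have n0 : n.+1%:R != 0 :> R[i] by rewrite pnatr_eq0.
have := ad_diag_annihilator n0 u0 ul Xb sE s0; rewrite big_map => M0.
have [a la] : exists a : R, l = a%:C.
  (* ub is an eigenvector of x for the conjugate of l. *)
  pose ub := map_mx (@conjc R) u.
  have ubl : ub *m cmx x = l^*%C *: ub.
    rewrite -map_mxZ -ul map_mxM; congr (_ *m _).
    by apply/matrixP => i j; rewrite !mxE; apply/esym/conjc_real.
  have ub0 : ub != 0 by rewrite map_mx_eq0.
  have ubM t : ub *m \prod_(c <- t) (cmx x - (l + c%:C)%:M) =
      (\prod_(c <- t) (l^*%C - (l + c%:C))) *: ub.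
    elim: t => [|c t IH]; first by rewrite !big_nil mulmx1 scale1r.
    rewrite !big_cons mul_mulmx mulmxA mulmxBr ubl mul_mx_scalar -scalerBl -scalemxAl IH.
    by rewrite scalerA.
  have := ubM s; rewrite M0 mulmx0 => /esym/eqP.
  rewrite scaler_eq0 (negPf ub0) orbF prodf_seq_eq0 => /hasP[c _ /=].
  case: (l) => p q /=; rewrite subr_eq0 => /eqP[_ /eqP].
  by rewrite addr0 eq_sym -addr_eq0 -mulr2n mulrn_eq0 /= => /eqP ->; exists p.
have M0R : \prod_(c <- s) (x - (a + c)%:M) = 0.
  have: map_mx (real_complex R) (\prod_(c <- s) (x - (a + c)%:M)) = 0.
    rewrite -M0 la; elim: (s) => [|c t IH]; first by rewrite !big_nil map_mx1.
    rewrite !big_cons !mul_mulmx map_mxM IH; congr (_ *m _).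
    by rewrite map_mxB map_scalar_mx rmorphD.
  by move/eqP; rewrite map_mx_eq0 => /eqP.
have /diagonalizableP : exists2 ls, uniq ls & mxminpoly x %| \prod_(b <- ls) ('X - b%:P).
  exists [seq a + c | c <- s]; first by rewrite map_inj_uniq ?undup_uniq //; apply: addrI.
  apply: mxminpoly_min; rewrite rmorph_prod big_map /= -[RHS]M0R.
  by apply: eq_bigr => c _; rewrite rmorphB /= horner_mx_X horner_mx_C.
case=> P Pu /(diagonalizable_forLR Pu)[d ->].
exists (invmx P); first by rewrite unitmx_inv.
by exists d; rewrite mxpoly.conjVmx // mulmxK.
Qed.

(** * The saturation of the nilradical *)

Lemma rank_bounded_similar (F : fieldType) (T : realDomainType) (n : nat)
    (d : 'I_n -> T) (U A B : 'M[F]_n) :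
  U \in unitmx -> U *m A = B *m U -> rank_bounded d A -> rank_bounded d B.
Proof.
by move=> Uu UA rA t ut; rewrite -(mxrank_conj Uu (expmx_conj _ UA)) rA.
Qed.

Lemma diag_mx_of_det (F : fieldType) (n : nat) (c : F) :
  (0 < n)%N -> c != 0 ->
  exists a b : 'rV[F]_n, diag_mx a *m diag_mx b = 1%:M /\ \det (diag_mx a) = c.
Proof.
case: n => // n _ c0; pose a : 'rV[F]_n.+1 := \row_i (if i == 0 then c else 1).
exists a, (\row_i (a 0 i)^-1); split.
  apply/matrixP => i j; rewrite mul_mx_diag !mxE.
  case: (eqVneq i j) => [->|_]; last by rewrite mulr0n mul0r.
  by rewrite mulr1n divff //; case: ifP; rewrite ?oner_neq0.
rewrite det_diag (bigD1 0) //= big1 => [|i /negPf i0]; rewrite !mxE ?i0 //.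
by rewrite eqxx mulr1.
Qed.

Lemma invmx_eq (F : fieldType) (n : nat) (A B : 'M[F]_n) :
  A *m B = 1%:M -> invmx A = B.
Proof.
move=> AB; have [uA _] := mulmx1_unit AB.
by rewrite -[RHS](mulKmx uA) AB mulmx1.
Qed.

(** An invertible matrix differs from one of determinant 1 by a diagonal matrix,
    which preserves both the diagonal matrices and the nilradicals: this turns
    GL-conjugacy into SL-conjugacy over any field. *)
Lemma SL_mod_torus (F : fieldType) (n : nat) (h g : 'M[F]_n) :
  (0 < n)%N -> h \in unitmx -> g \in unitmx ->
  exists a b : 'rV[F]_n, diag_mx a *m diag_mx b = 1%:M /\
    exists2 k, SL k & forall z, Ad k (Ad h (diag_mx b *m z *m diag_mx a)) = Ad g z.
Proof.
move=> n0 hu gu; have c0 : (\det (g *m invmx h))^-1 != 0.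
  by rewrite invr_eq0 -unitfE -unitmxE unitmx_mul gu unitmx_inv.
have [a [b [ab da]]] := diag_mx_of_det n0 c0; exists a, b; split => //.
exists (g *m diag_mx a *m invmx h) => [|z].
  rewrite /SL /= !det_mulmx da mulrAC -det_mulmx divff // -invr_eq0 //.
rewrite /Ad (@invmx_eq _ _ (g *m diag_mx a *m invmx h)
  (h *m diag_mx b *m invmx g)); last first.
  by rewrite !mulmxA mulmxKV // -(mulmxA g) ab mulmx1 mulmxV.
rewrite !mulmxA !mulmxKV // -(mulmxA g (diag_mx a)) ab mulmx1.
by rewrite -(mulmxA (g *m z) (diag_mx a)) ab mulmx1.
Qed.

Section Nilradical.
Variables (R : realType) (n : nat) (x h : 'M[R]_n) (d : 'rV[R]_n).
Hypotheses (hu : h \in unitmx) (xh : x *m h = h *m diag_mx d).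
Let H := cmx h.
Let D : 'M[R[i]]_n := diag_mx (\row_i (d 0 i)%:C).

Lemma cmx_unitmx : H \in unitmx.
Proof. by rewrite map_unitmx. Qed.

Lemma cmx_diagonalized : cmx x *m H = H *m D.
Proof.
rewrite -map_mxM xh map_mxM; congr (_ *m _).
by apply/matrixP => i j; rewrite !mxE rmorphMn.
Qed.

(** In the eigenbasis of x, the operator ad x acts on the entry (i, j) by
    d_i - d_j. *)
Lemma nilradE z :
  nilrad x z <-> exists2 w, std_nilrad (d 0) w & z = H *m w *m invmx H.
Proof.
have Hu := cmx_unitmx; have xH := cmx_diagonalized; split.
  case=> k [mu [w [wE ->]]]; exists (\sum_i invmx H *m w i *m H); last first.
    rewrite mulmx_sumr mulmx_suml; apply: eq_bigr => i _.
    by rewrite !mulmxA mulmxV // mul1mx mulmxK.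
  move=> i j; rewrite summxE => /eqP h0.
  have [l wl] : exists l, (invmx H *m w l *m H) i j != 0.
    apply/existsP; apply: contra_notT h0 => /existsPn w0.
    by apply: big1 => l _; apply/eqP; have := w0 l; rewrite negbK.
  have [mu0 [_ adw]] := wE l.
  set y := invmx H *m w l *m H in wl.
  have : D *m y - y *m D = (mu l)%:C *: y.
    rewrite /y scalemxAl scalemxAr -adw /ad mulmxBr mulmxBl.
    congr (_ - _); last by rewrite -!mulmxA xH.
    by rewrite -[D](mulKmx Hu) -xH !mulmxA mulmxK.
  clearbody y => /matrixP/(_ i j); rewrite mul_diag_mx mul_mx_diag !mxE.
  rewrite (mulrC (y i j)) -mulrBl.
  move=> /(mulIf wl); rewrite -rmorphB => /complexI dE.
  by rewrite -subr_gt0 dE.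
case=> w uw ->; pose P := ('I_n * 'I_n)%type.
pose v (p : P) : 'M[R[i]]_n := w p.1 p.2 *: (H *m delta_mx p.1 p.2 *m invmx H).
(* The pairs with d_i <= d_j carry a zero vector; any positive eigenvalue would do
   for it. *)
exists #|{: P}|, (fun l => let p := enum_val l in
  if d 0 p.2 < d 0 p.1 then d 0 p.1 - d 0 p.2 else 1), (fun l => v (enum_val l)).
split=> [l|]; last first.
  rewrite -(big_enum_val (A := {: P})) /= {1}[w]matrix_sum_delta pair_big /=.
  by rewrite mulmx_sumr mulmx_suml; apply: eq_bigr => p _; rewrite -scalemxAr -scalemxAl.
case: (enum_val l) => i j /=; case: ifPn => ij; last first.
  have w0 : w i j = 0 by apply/eqP; apply: contraNT ij; apply: uw.
  split; first exact: ltr01.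
  by rewrite /v /= w0 scale0r /ad_eigenspace /= mem0v /ad mulmx0 mul0mx subr0 scaler0.
split; first by rewrite subr_gt0.
split.
  rewrite mem_sl /v /= linearZ /= mxtrace_mulC mulmxA mulVmx // mul1mx.
  rewrite /mxtrace big1 ?mulr0 // => k _; rewrite mxE.
  case: eqP => // ->; case: eqP => // ji; move: ij; by rewrite ji ltxx.
rewrite /v /ad /= -!scalemxAr -!scalemxAl scalerA mulrC -scalerA -scalerBr; congr (_ *: _).
have -> : cmx x *m (H *m delta_mx i j *m invmx H) = H *m (D *m delta_mx i j) *m invmx H.
  by rewrite !mulmxA xH.
have -> : H *m delta_mx i j *m invmx H *m cmx x = H *m (delta_mx i j *m D) *m invmx H.
  rewrite -[D](mulKmx Hu) -xH !mulmxA mulmxK //.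
rewrite -mulmxBl -mulmxBr scalemxAl scalemxAr; congr (_ *m _ *m _).
apply/matrixP => a b; rewrite mul_diag_mx mul_mx_diag !mxE rmorphB.
case: eqP => [->|_]; last by rewrite !mul0r !mulr0 subrr.
case: eqP => [->|_]; last by rewrite !mul0r !mulr0 subrr.
by rewrite mul1r !mulr1.
Qed.

Lemma saturation_nilradE (z : 'M[R[i]]_n) : (0 < n)%N ->
  saturation (nilrad x) z <-> rank_bounded (d 0) z.
Proof.
move=> n0; have Hu := cmx_unitmx; split.
  case=> g SLg [y /nilradE[w uw ->] ->].
  have gu : g \in unitmx by rewrite unitmxE SLg unitr1.
  have := std_nilrad_rank_bounded (@complexI R) uw.
  apply: (rank_bounded_similar (U := g *m H)); first by rewrite unitmx_mul gu.
  by rewrite /Ad -!mulmxA (mulmxA (invmx g)) mulVmx // mul1mx mulVmx // mulmx1.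
move=> /rank_bounded_conj_nilrad[g [w [gu gz uw]]].
have giu : invmx g \in unitmx by rewrite unitmx_inv.
have [a [b [_ [k SLk kE]]]] := SL_mod_torus n0 Hu giu.
exists k => //; exists (Ad H (diag_mx b *m w *m diag_mx a)).
  by apply/nilradE; exists (diag_mx b *m w *m diag_mx a) => //; apply: std_nilrad_diag.
by rewrite kE /Ad invmxK -mulmxA -gz mulKmx.
Qed.

Lemma rank_bounded_cmx (y : 'M[R]_n) : rank_bounded (d 0) (cmx y) <-> rank_bounded (d 0) y.
Proof.
have E k : \rank (cmx y ^+ k) = \rank (y ^+ k).
  rewrite -(mxrank_map (real_complex R) (y ^+ k)); congr (\rank _).
  elim: k => [|k IH]; first by rewrite !expr0 map_mx1.
  by rewrite !exprS !mul_mulmx map_mxM IH.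
by split=> ry t ut; have := ry t ut; rewrite E.
Qed.

Lemma real_points_saturationE : (0 < n)%N ->
  real_points (saturation (nilrad x)) = [set y | y \in sl R n /\ rank_bounded (d 0) y].
Proof.
move=> n0; apply/seteqP; split=> y /= [ysl ry]; split=> //.
  by apply/rank_bounded_cmx/saturation_nilradE.
by apply/saturation_nilradE => //; apply/rank_bounded_cmx.
Qed.

End Nilradical.

(** * The Richardson orbit and its Zariski closure *)

(** A matrix with a k-th power of rank more than r would have det (P z^k Q) = 1
    for some constant P and Q, while this polynomial in z vanishes on A. *)
Lemma zariski_rank_exp (F : fieldType) (n k r : nat) (A : set 'M[F]_n) (z : 'M[F]_n) :
  (forall y, A y -> (\rank (y ^+ k) <= r)%N) ->
  zariski_closure A z -> (\rank (z ^+ k) <= r)%N.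
Proof.
move=> Ar [_ Az]; rewrite leqNgt; apply/negP => /mxrank_geP[P [Q PzQ]].
pose X : 'M[mpoly.mpoly (n * n) F]_n :=
  \matrix_(i, j) mpoly.mpolyX F (mpoly.mnm1 (mxvec_index i j)).
pose cst := @mpoly.mpolyC (n * n) F.
pose p := \det (map_mx cst P *m X ^+ k *m map_mx cst Q).
have pE y : mpoly.meval (fun l => mxvec y 0 l) p = \det (P *m y ^+ k *m Q).
  pose ev : {rmorphism mpoly.mpoly (n * n) F -> F} :=
    mpoly.meval (fun l => mxvec y 0 l).
  rewrite -[LHS]/(ev p).
  have evX e : map_mx ev (X ^+ e) = y ^+ e.
    elim: e => [|e IH]; first by rewrite !expr0 map_mx1.
    rewrite !exprS !mul_mulmx map_mxM IH; congr (_ *m _).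
    by apply/matrixP => i j; rewrite !mxE /= mpoly.mevalXU mxvecE.
  rewrite -det_map_mx !map_mxM evX -!map_mx_comp; congr (\det (_ *m _ *m _)).
    by apply/matrixP => i j; rewrite !mxE /= mpoly.mevalC.
  by apply/matrixP => i j; rewrite !mxE /= mpoly.mevalC.
have := Az p; rewrite pE PzQ det1 => /(_ _)/eqP; rewrite oner_eq0 => H.
apply/notF/H => y Ay; rewrite pE; apply/eqP/negPn/negP => /det_neq0_rank.
by rewrite ltnNge Ar.
Qed.

Lemma meval_line (F : fieldType) (N : nat) (p : mpoly.mpoly N F) (a b : 'I_N -> F) :
  exists q : {poly F}, forall t, q.[t] = mpoly.meval (fun l => a l + t * b l) p.
Proof.
exists (\sum_(m <- mpoly.msupp p) (mpoly.mcoeff m p)%:P *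
          \prod_i ((a i)%:P + 'X * (b i)%:P) ^+ (m i)) => t.
rewrite mpoly.mevalE horner_sum; apply: eq_bigr => m _.
rewrite hornerM hornerC horner_prod; congr (_ * _); apply: eq_bigr => i _.
by rewrite horner_exp !hornerE.
Qed.

(** Over an algebraically closed field a scalar multiple of g has
    determinant 1. *)
Lemma orbit_unit (C : numClosedFieldType) (n : nat) (g e : 'M[C]_n) :
  (0 < n)%N -> g \in unitmx -> Defs.orbit e (Ad g e).
Proof.
move=> n0 gu; have dg : \det g != 0 by rewrite -unitfE -unitmxE.
pose c := n.-root (\det g)^-1.
have cn : c ^+ n = (\det g)^-1 by rewrite rootCK.
have c0 : c != 0 by apply: contraNneq dg => c0; rewrite -invr_eq0 -cn c0 expr0n gtn_eqF.
exists (c *: g); first by rewrite /SL /= detZ cn mulVf.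
exists e => //; rewrite /Ad (@invmx_eq _ _ (c *: g) (c^-1 *: invmx g)).
  by rewrite -scalemxAr -!scalemxAl scalerA mulVf // scale1r.
by rewrite -scalemxAr -scalemxAl scalerA mulVf // scale1r mulmxV.
Qed.

Lemma std_nilrad_nilpotent (F : numFieldType) (T : realDomainType)
    (f : T -> F) (n : nat) (d : 'I_n -> T) :
  injective f -> exists m, forall w : 'M[F]_n, std_nilrad d w -> w ^+ m = 0.
Proof.
move=> finj; pose t := undup [seq d i | i <- enum 'I_n]; exists (size t) => w uw.
apply/eqP; rewrite -mxrank_eq0 -leqn0.
apply: leq_trans (std_nilrad_rank_bounded finj uw (undup_uniq _)) _.
rewrite leqn0; apply/eqP/eq_card0 => i; rewrite inE.
by rewrite mem_undup map_f ?mem_enum.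
Qed.

(** e maximizes the sum of the ranks of the powers over the nilradical. On the
    line from w to e the rank of each power is generically at least that for e,
    so by maximality all of them are equal to those for e. *)
Lemma std_nilrad_generic (F : numFieldType) (T : realDomainType)
    (f : T -> F) (n : nat) (d : 'I_n -> T) :
  injective f -> exists2 e : 'M[F]_n, std_nilrad d e &
    forall w, std_nilrad d w -> exists2 p : {poly F}, p != 0 &
      forall t, p.[t] != 0 ->
        exists2 g, g \in unitmx & g *m (w + t *: (e - w)) = e *m g.
Proof.
move=> finj; have [m nilp] := @std_nilrad_nilpotent F T f n d finj.
pose S (w : 'M[F]_n) := (\sum_(k < m) \rank (w ^+ k))%N.
pose Q s := `[< exists2 w : 'M[F]_n, std_nilrad d w & S w = s >].
have exQ : exists s, Q s.
  exists (S 0); apply/asboolP; exists 0 => // i j; by rewrite mxE eqxx.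
have ubQ s : Q s -> (s <= m * n)%N.
  move=> /asboolP[w _ <-]; rewrite -[X in (_ <= X * _)%N]card_ord -sum_nat_const.
  by apply: leq_sum => k _; apply: rank_leq_row.
case: (ex_maxnP exQ ubQ) => s /asboolP[e ue Se] smax.
exists e => // w uw.
pose L : 'M[{poly F}]_n := map_mx polyC w + 'X *: map_mx polyC (e - w).
have LE k t : map_mx (horner_eval t) (L ^+ k) = (w + t *: (e - w)) ^+ k.
  elim: k => [|k IH]; first by rewrite !expr0 map_mx1.
  rewrite !exprS !mul_mulmx map_mxM IH; congr (_ *m _).
  by apply/matrixP => i j; rewrite !mxE /= horner_evalE !hornerE.
have L1 k : map_mx (horner_eval 1) (L ^+ k) = e ^+ k.
  by rewrite LE scale1r addrC subrK.
have /choice[p pE] : forall k : nat, exists p : {poly F}, p.[1] != 0 /\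
    forall t, p.[t] != 0 -> (\rank (e ^+ k) <= \rank ((w + t *: (e - w)) ^+ k))%N.
  move=> k; have := leqnn (\rank (e ^+ k)); rewrite -{2}L1.
  by move=> /rank_horner_generic[p p1 pt]; exists p; split=> // t /pt; rewrite LE.
exists (\prod_(k < m) p k).
  apply/negP => /eqP/(congr1 (horner^~ 1)); rewrite horner_prod horner0 => /eqP.
  rewrite prodf_seq_eq0 => /hasP[k _]; rewrite (negPf (pE k).1) //.
move=> t; rewrite horner_prod => /prodf_neq0 pt.
set wt := w + _.
have uwt : std_nilrad d wt.
  move=> i j; rewrite !mxE; apply: contraNT => ij.
  have w0 (v : 'M[F]_n) : std_nilrad d v -> v i j = 0.
    by move=> uv; apply/eqP; apply: contraNT ij; apply: uv.
  by rewrite !w0 // subr0 mulr0 addr0.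
have Sle : (S wt <= S e)%N by rewrite Se; apply: smax; apply/asboolP; exists wt.
have le_rk (k : 'I_m) : (\rank (e ^+ k) <= \rank (wt ^+ k))%N.
  by apply: (pE k).2; apply: pt.
have eq_rk k : \rank (wt ^+ k) = \rank (e ^+ k).
  case: (ltnP k m) => km; last first.
    by rewrite -(subnKC km) !exprD !nilp // !mul0r.
  have [_] := leqif_sum (fun (i : 'I_m) (_ : true) => leqif_eq (le_rk i)).
  rewrite eqn_leq Sle andbT leq_sum // => /esym/forallP/(_ (Ordinal km))/eqP <- //.
exact: nilpotent_similar (nilp _ uwt) eq_rk.
Qed.

Lemma Ad_mul (F : fieldType) (n : nat) (g h z : 'M[F]_n) :
  g \in unitmx -> h \in unitmx -> Ad (g *m h) z = Ad g (Ad h z).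
Proof.
move=> gu hu; rewrite /Ad (@invmx_eq _ _ (g *m h) (invmx h *m invmx g)) ?mulmxA //.
by rewrite mulmxK // mulmxV.
Qed.

Lemma Ad_line (F : fieldType) (n : nat) (g a b : 'M[F]_n) t :
  Ad g (a + t *: b) = Ad g a + t *: Ad g b.
Proof. by rewrite /Ad mulmxDr mulmxDl -scalemxAr -scalemxAl. Qed.

Section Richardson.
Variables (R : realType) (n : nat) (x h : 'M[R]_n) (d : 'rV[R]_n).
Hypotheses (n0 : (0 < n)%N) (hu : h \in unitmx) (xh : x *m h = h *m diag_mx d).
Let H := cmx h.

Lemma nilrad_sl z : nilrad x z -> z \in sl R[i] n.
Proof. by move=> [k [mu [w [wE ->]]]]; apply: memv_suml => i _; case: (wE i) => _ []. Qed.

Lemma Ad_sl (F : fieldType) (g z : 'M[F]_n) :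
  g \in unitmx -> z \in sl F n -> Ad g z \in sl F n.
Proof. by move=> gu; rewrite !mem_sl /Ad mxtrace_mulC mulmxA mulVmx // mul1mx. Qed.

(** A polynomial that vanishes on the orbit of e restricts to a polynomial q in
    the parameter of the line from w to e. It vanishes off the roots of the
    polynomial p of std_nilrad_generic, so p q = 0 and q = 0; the parameter 0
    then gives the value at w. *)
Lemma richardson_orbit_exists : exists O, is_richardson_orbit x O.
Proof.
have Hu : H \in unitmx by apply: cmx_unitmx.
have [e ue egen] := @std_nilrad_generic _ _ _ n (d 0) (@complexI R).
have eN : nilrad x (Ad H e) by apply/(nilradE hu xh); exists e.
exists (Defs.orbit (Ad H e)); split.
- by exists (Ad H e) => //; apply: nilrad_sl.
- by move=> y [g SLg [_ -> ->]]; exists g => //; exists (Ad H e).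
move=> y [g SLg [_ /(nilradE hu xh)[w uw ->] ->]].
have gu : g \in unitmx by rewrite unitmxE SLg unitr1.
rewrite -/(Ad (cmx h) w) -/H; split.
  by apply: Ad_sl => //; apply: nilrad_sl; apply/(nilradE hu xh); exists w.
move=> P P0; have [p p0 pE] := egen w uw.
pose Y0 := Ad g (Ad H w); pose Y1 := Ad g (Ad H (e - w)).
have [q qE] := meval_line P (fun l => mxvec Y0 0 l) (fun l => mxvec Y1 0 l).
have qY t : q.[t] =
    mpoly.meval (fun l => mxvec (Ad g (Ad H (w + t *: (e - w)))) 0 l) P.
  rewrite qE; apply: mpoly.meval_eq => l.
  by rewrite !Ad_line -/Y0 -/Y1 linearD linearZ /= !mxE.
have pq : p * q = 0.
  apply/eqP/negPn/negP => /poly_nonroot[t]; rewrite hornerM mulf_eq0 negb_or => /andP[pt].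
  rewrite qY P0 ?eqxx //; have [k ku kE] := pE t pt.
  have Gu : H *m invmx k *m invmx H \in unitmx by rewrite !unitmx_mul !unitmx_inv Hu ku.
  have -> : Ad H (w + t *: (e - w)) = Ad (H *m invmx k *m invmx H) (Ad H e).
    have kiu : invmx k \in unitmx by rewrite unitmx_inv.
    rewrite -(Ad_mul _ Gu Hu) (mulmxKV Hu) (Ad_mul _ Hu kiu); congr (Ad H _).
    by rewrite /Ad invmxK -[invmx k *m e *m k]mulmxA -kE mulKmx.
  rewrite -(Ad_mul _ gu Gu); apply: (orbit_unit _ n0).
  by rewrite unitmx_mul gu Gu.
have q0 : q = 0 by move/eqP: pq; rewrite mulf_eq0 (negPf p0) => /eqP.
have := qE 0; rewrite q0 horner0 => ->.
by apply: mpoly.meval_eq => l; rewrite mul0r addr0.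
Qed.

Lemma richardson_closure :
  zariski_closure (richardson_orbit x) = saturation (nilrad x).
Proof.
have [_ Osub Odense] := xgetPex set0 richardson_orbit_exists.
rewrite -/(richardson_orbit x) in Osub Odense.
apply/seteqP; split => // z zO; apply/(saturation_nilradE hu xh) => // t ut.
apply: zariski_rank_exp zO => y /Osub /(saturation_nilradE hu xh) - /(_ n0) ry.
exact: ry.
Qed.

End Richardson.

(** * The limit of orbits *)

Section Limit.
Variables (R : realType).

(** Entrywise continuity passes to products and determinants, whose entries are
    sums of products of entries. *)
Definition mx_continuous (U : topologicalType) (m n : nat) (f : U -> 'M[R]_(m, n)) :=
  forall i j, continuous (fun q => f q i j).

Lemma mx_continuousM (U : topologicalType) (m n p : nat)
    (f : U -> 'M[R]_(m, n)) (g : U -> 'M[R]_(n, p)) :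
  mx_continuous f -> mx_continuous g -> mx_continuous (fun q => f q *m g q).
Proof.
move=> cf cg i j; under eq_fun do rewrite mxE.
apply: continuous_big => [|k _ q]; first exact: add_continuous.
by apply: continuousM; [apply: cf | apply: cg].
Qed.

Lemma mx_continuous_cst (U : topologicalType) (m n : nat) (A : 'M[R]_(m, n)) :
  mx_continuous (fun _ : U => A).
Proof. by move=> i j q; apply: cst_continuous. Qed.

Lemma mx_continuous_det (U : topologicalType) (n : nat) (f : U -> 'M[R]_n) :
  mx_continuous f -> continuous (fun q => \det (f q)).
Proof.
move=> cf; apply: continuous_big => [|s _ q]; first exact: add_continuous.
apply: (@continuousM R _ (fun=> (-1) ^+ s) (fun q => \prod_i f q i (s i)));
  first exact: cst_continuous.
suff cp : continuous (fun q => \prod_i f q i (s i)) by exact: cp.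
by apply: continuous_big => [|i _]; [exact: mul_continuous | exact: cf].
Qed.

Lemma mx_continuous_shifted_prod (n : nat) (t : seq R) :
  mx_continuous (fun q : R * 'M[R]_n => \prod_(c <- t) (q.2 - (q.1 * c)%:M)).
Proof.
elim: t => [|c t IH].
  under eq_fun do rewrite big_nil; exact: mx_continuous_cst.
under eq_fun do rewrite big_cons.
apply: mx_continuousM IH => i j; under eq_fun do rewrite !mxE.
move=> q; apply: (@cvgB R R^o).
  apply: (@continuous_comp _ _ _ snd (fun M : 'M[R]_n => M i j) q); first exact: cvg_snd.
  exact: coord_continuous.
case: (i == j); rewrite ?mulr1n ?mulr0n; last exact: cst_continuous.
by apply: continuousM; [exact: cvg_fst | exact: cst_continuous].
Qed.

End Limit.

(** A nonzero det (P y^k Q) is the value at (0, y) of a continuous function of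
    (nu, z), so it stays nonzero at some z in an orbit of nu x close to y, where
    the rank of the shifted product is too small. *)
Lemma orbit_limit_rank_bounded (R : realType) (n : nat) (x h : 'M[R]_n)
    (d : 'rV[R]_n) (y : 'M[R]_n) :
  h \in unitmx -> x *m h = h *m diag_mx d ->
  orbit_limit x y -> rank_bounded (d 0) y.
Proof.
move=> hu xh ylim t ut; rewrite leqNgt; apply/negP => /mxrank_geP[P [Q PQ]].
pose f (q : R * 'M[R]_n) := \det (P *m (\prod_(c <- t) (q.2 - (q.1 * c)%:M)) *m Q).
have cf : continuous f.
  apply: mx_continuous_det; apply: mx_continuousM; last exact: mx_continuous_cst.
  apply: mx_continuousM; first exact: mx_continuous_cst.
  exact: mx_continuous_shifted_prod.
have f0 : f (0, y) != 0.
  rewrite /f /=; have -> : \prod_(c <- t) (y - (0 * c)%:M) = y ^+ size t.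
    elim: (t) => [|c s IH]; first by rewrite big_nil.
    by rewrite big_cons IH exprS mul0r raddf0 subr0.
  by rewrite PQ det1 oner_neq0.
have [[A B] /= [A0 By] AB] := cvgr_neq0 _ (cf (0, y)) f0.
have /nbhs_ballP[eps /= eps0 epsA] := A0.
have [ycl _] := ylim eps eps0.
have [z [[nu /andP[nu0 nueps] [g SLg [_ -> zE]]] Bz]] := ycl B By.
have gu : g \in unitmx by rewrite unitmxE SLg unitr1.
have : f (nu, z) != 0.
  apply: (AB (nu, z)); split => //=; apply: epsA.
  by rewrite /ball /= sub0r normrN gtr0_norm.
move=> /det_neq0_rank; rewrite ltnNge => /negP; apply.
have ghu : g *m h \in unitmx by rewrite unitmx_mul gu.
have zgh : (g *m h) *m diag_mx (nu *: d) = z *m (g *m h).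
  have -> : diag_mx (nu *: d) = nu *: diag_mx d.
    by apply/matrixP => i j; rewrite !mxE mulrnAr.
  rewrite zE /Ad !mulmxA mulmxKV // -!scalemxAr -scalemxAl.
  by rewrite -[in RHS]mulmxA xh mulmxA.
rewrite -(mxrankMfree _ (_ : row_free (g *m h))) ?row_free_unit //.
rewrite -(shifted_prod_conj _ _ zgh).
apply: leq_trans (mxrankM_maxr _ _) _.
by apply: (@rank_diag_prod _ _ _ (d 0)) => i; rewrite mxE.
Qed.

(** With y conjugate to w in the nilradical, the points obtained from w + nu D
    approach y as nu tends to 0, and they lie in the orbits of the nu x because
    the conjugacy class of nu D absorbs w. *)
Lemma rank_bounded_orbit_limit (R : realType) (n : nat) (x h : 'M[R]_n.+1)
    (d : 'rV[R]_n.+1) (y : 'M[R]_n.+1) :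
  h \in unitmx -> x *m h = h *m diag_mx d ->
  y \in sl R n.+1 -> rank_bounded (d 0) y -> orbit_limit x y.
Proof.
move=> hu xh ysl /rank_bounded_conj_nilrad[g [w [gu gy uw]]] eps /= eps0; split => // B By.
have giu : invmx g \in unitmx by rewrite unitmx_inv.
have yE : y = Ad (invmx g) w by rewrite /Ad invmxK -mulmxA -gy mulKmx.
pose phi nu := Ad (invmx g) (w + nu *: diag_mx d).
have phi0 : phi nu @[nu --> 0^'+] --> y.
  rewrite -[y]addr0 -[X in _ + X](scale0r (Ad (invmx g) (diag_mx d))) {1}yE.
  rewrite /phi; under eq_fun do rewrite Ad_line.
  apply: cvgD; first exact: cvg_cst.
  apply: cvgZl; apply: cvg_at_right_filter; exact: cvg_id.
have : \forall nu \near 0^'+, B (phi nu) /\ 0 < nu < eps.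
  near=> nu; split; first by near: nu; apply: phi0.
  by apply/andP; split; near: nu; [exact: nbhs_right_gt | exact: nbhs_right_lt].
move=> /filter_ex[nu [Bnu nueps]]; exists (phi nu); split => //.
exists nu => //; have nu0 : nu != 0 by rewrite gt_eqF //; case/andP: nueps.
have dE : diag_mx (nu *: d) = nu *: diag_mx d by apply/matrixP => i j; rewrite !mxE mulrnAr.
have [|k ku kE] := @diag_add_nilrad_conj _ _ _ (d 0) (nu *: d) w _ uw.
  move=> i j ji; rewrite !mxE; apply: contraTneq ji => /(mulfI nu0) ->.
  by rewrite ltxx.
have gku : invmx g *m k \in unitmx by rewrite unitmx_mul giu.
have [a [b [ab [K SLK KE]]]] := SL_mod_torus (ltn0Sn n) hu gku.
exists K => //; exists (nu *: x) => //.
have -> : nu *: x = Ad h (nu *: diag_mx d).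
  by rewrite /Ad -scalemxAr -scalemxAl -xh mulmxK.
have := KE (diag_mx (nu *: d)); rewrite [in LHS]diag_mx_comm -mulmxA (mulmx1C ab) mulmx1.
rewrite -dE => ->; rewrite Ad_mul // /phi -dE; congr (Ad _ _).
by rewrite /Ad -kE mulmxK // addrC.
Unshelve. all: by end_near.
Qed.

Theorem corollary6p3 (R : realType) (n : nat) (hn : (2 <= n)%N)
    (x : 'M[R]_n) (hx : hyperbolic x) :
  orbit_limit x = real_points (saturation (nilrad x)) /\
  real_points (saturation (nilrad x)) =
    real_points (zariski_closure (richardson_orbit x)).
Proof.
case: n hn x hx => // n _ x hx.
have [h hu [d xh]] := hyperbolic_diag (ltn0Sn n) hx.
rewrite (richardson_closure (ltn0Sn n) hu xh); split => //.
rewrite (real_points_saturationE hu xh) //; apply/seteqP; split=> y.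
  move=> ylim; split; last by apply: (orbit_limit_rank_bounded hu xh).
  by have [_] := ylim 1 ltr01.
by move=> [ysl ry]; apply: (rank_bounded_orbit_limit hu xh).
Qed.
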